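(* Let $R$ be a unique factorization domain with field of fractions $k$, let $\varphi\colon\mathbf{Z}\to R$ be the canonical ring homomorphism, and let $T(x,y)=\sum_{i,j}t_{i,j}x^iy^j\in R[x,y]$ be an $(n,r)$-Brylawski polynomial, where $n,r$ are integers with $r\geq 1$ and $n-r\geq 1$. Suppose that (i) none of $x-1$, $y-1$, $x$, $y$ divides $T(x,y)$; (ii) $\varphi(2)\nmid t_{1,1}$; and (iii) $\deg_x T+\deg_y T=n$. Then $T(x,y)$ is irreducible in $k[x,y]$; moreover, if $\gcd_{i,j}\{t_{i,j}\}=1$ in $R$, then $T(x,y)$ is irreducible in $R[x,y]$.
   Context: For a commutative ring $R$, a polynomial $U(x,y)\in R[x,y]$ is called an $(n,r)$-Brylawski polynomial (with constant $c$) if $(y-1)^rU\big(\frac{y}{y-1},y\big)=cy^n$ for some non-negative integer $n$, some integer $r$, and some non-zero constant $c\in R$. For $U=\sum u_{i,j}x^iy^j$, $\deg_x U=\max\{i:\exists j,\ u_{i,j}\neq 0\}$ and $\deg_y U=\max\{j:\exists i,\ u_{i,j}\neq 0\}$. *)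

(* Defs.v *)
From mathcomp Require Import all_boot all_order all_algebra.

Set Implicit Arguments.
Unset Strict Implicit.
Unset Printing Implicit Defensive.

Import GRing.Theory.
Local Open Scope ring_scope.

(* The relation %| of polydiv is pseudo-divisibility, which allows the dividend
   to be rescaled by a non-unit constant, and irreducible_poly treats all
   constants as trivial factors; over R[x,y], with R not a field, neither one
   is the ring-theoretic notion, hence the following definitions. *)
Definition divides (A : comNzRingType) (a b : A) : Prop :=
  exists c : A, b = c * a.

Definition irreducible (A : idomainType) (a : A) : Prop :=
  [/\ a != 0,
      a \isn't a GRing.unit
    & forall b c : A, a = b * c ->
        b \is a GRing.unit \/ c \is a GRing.unit].

Definition associates (A : idomainType) (a b : A) : Prop :=
  exists2 u : A, u \is a GRing.unit & b = u * a.

Definition is_ufd (A : idomainType) : Prop :=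
  (forall a : A, a != 0 -> a \isn't a GRing.unit ->
     exists2 s : seq A, (forall p, p \in s -> irreducible p)
                      & a = \prod_(p <- s) p)
  /\
  (forall s t : seq A,
     (forall p, p \in s -> irreducible p) ->
     (forall q, q \in t -> irreducible q) ->
     \prod_(p <- s) p = \prod_(q <- t) q ->
     size s = size t /\
     exists2 t' : seq A, perm_eq t t'
       & forall i, (i < size s)%N -> associates s`_i t'`_i).

(* gcds are determined only up to a unit, so "the gcd of F is d" is the
   statement that d is one of them. *)
Definition is_gcd (A : idomainType) (F : nat -> nat -> A) (d : A) : Prop :=
  (forall i j, divides d (F i j)) /\
  (forall e : A, (forall i j, divides e (F i j)) -> divides e d).

(* R[x,y] is {poly {poly R}} with the convention of polyXY: the outer variable
   is x = 'X, the inner one is y = 'Y = 'X%:P, so that the coefficient of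
   x^i y^j in U is U`_i`_j. *)

(* Meaningful for nonzero U only, size being degree + 1. *)
Definition degX (R : idomainType) (U : {poly {poly R}}) : nat := (size U).-1.
Definition degY (R : idomainType) (U : {poly {poly R}}) : nat := (sizeY U).-1.

(* The identity is read in the field of fractions R(y) of R[y], which contains
   both y / (y - 1) and the negative powers of y - 1. *)
Definition brylawski_with_constant (R : idomainType) (n : nat) (r : int) (c : R)
    (U : {poly {poly R}}) : Prop :=
  let y : {fraction {poly R}} := tofrac 'X in
  (y - 1) ^ r * (map_poly (@tofrac _) U).[y / (y - 1)]
    = tofrac c%:P * y ^+ n.

Definition is_brylawski (R : idomainType) (n : nat) (r : int)
    (U : {poly {poly R}}) : Prop :=
  exists2 c : R, c != 0 & brylawski_with_constant n r c U.

Definition to_fraction_field (R : idomainType) (U : {poly {poly R}}) :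
    {poly {poly {fraction R}}} :=
  map_poly (map_poly (@tofrac R)) U.

(* Main.v *)
(** Substituting x = y/(y-1) into U and clearing denominators gives P_U =
   (y-1)^(deg_x U) U(y/(y-1), y) in R[y] (brylawski_poly U below), which is
   multiplicative in U and of degree at most deg_x U + deg_y U. Since deg_x T
   + deg_y T = n, comparing degrees forces P_T = c y^n; so if T = AB then P_A
   and P_B are monomials, necessarily of the top degrees deg_x + deg_y. If
   that degree is positive, the constant coefficient of A vanishes, so A is
   divisible by x or y as soon as it involves only one variable. Otherwise the
   coefficient of y in P_A vanishes too, which reads a_(1,0) = a_(0,1). If
   this happens for both A and B, then t_(1,1) = a_(1,0) b_(0,1) + a_(0,1)
   b_(1,0) = 2 a_(1,0) b_(1,0). Gauss's lemma transports factorizations from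
   k[x,y] to R[x,y]. *)

Require Import Defs.
From mathcomp Require Import all_boot all_order all_algebra.
Import GRing.Theory.
Local Open Scope ring_scope.

(** * Irreducible elements of a factorial ring are prime *)

Lemma divides_mul {A : comNzRingType} {a b : A} (c : A) :
  divides a b -> divides a (c * b).
Proof. by case=> d ->; exists (c * d); rewrite mulrA. Qed.

Lemma unit_factorization {A : idomainType} (hA : is_ufd A) (a : A) :
  a != 0 -> exists u s, [/\ u \is a GRing.unit,
    forall p, p \in s -> irreducible p & a = u * \prod_(p <- s) p].
Proof.
move=> a0; have [au|au] := boolP (a \is a GRing.unit).
  by exists a, [::]; split=> //; rewrite big_nil mulr1.
have [s sirr ->] := hA.1 a a0 au.
by exists 1, s; split; rewrite ?unitr1 ?mul1r.
Qed.

Lemma irreducible_unit_mul {A : idomainType} (u p : A) :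
  u \is a GRing.unit -> irreducible p -> irreducible (u * p).
Proof.
move=> uu [p0 pu pirr]; split.
- by rewrite mulf_neq0 //; apply: contraTneq uu => ->; rewrite unitr0.
- by rewrite unitrM uu.
move=> b c e; have /pirr : p = (u^-1 * b) * c by rewrite -mulrA -e mulKr.
by rewrite unitrM unitrV uu.
Qed.

Definition prime_element {A : comNzRingType} (p : A) : Prop :=
  p != 0 /\
  forall a b : A, divides p (a * b) -> divides p a \/ divides p b.

(** Factoring both sides of a b = c p, uniqueness pairs [p] with an irreducible factor of [a] or of
    [b]. *)
Lemma ufd_irreducible_prime {A : idomainType} (hA : is_ufd A) (p : A) :
  irreducible p -> prime_element p.
Proof.
move=> pirr; have [p0 _ _] := pirr; split=> // a b [c e].
have [->|a0] := eqVneq a 0; first by left; exists 0; rewrite mul0r.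
have [->|b0] := eqVneq b 0; first by right; exists 0; rewrite mul0r.
have c0 : c != 0.
  by apply: contra_neq (mulf_neq0 a0 b0) => c0; rewrite e c0 mul0r.
have [u [s [uu sirr ea]]] := unit_factorization hA _ a0.
have [v [t [vu tirr eb]]] := unit_factorization hA _ b0.
have [w [z [wu zirr ec]]] := unit_factorization hA _ c0.
have [k ku ek] : exists2 k, k \is a GRing.unit & k = u * v.
  by exists (u * v); rewrite ?unitrM ?uu.
(* Uniqueness compares products without unit factors, so all the units are absorbed into [p]. *)
pose q := (k^-1 * w) * p.
have qu : k^-1 * w \is a GRing.unit by rewrite unitrM unitrV ku.
have ep : \prod_(x <- q :: z) x = \prod_(x <- s ++ t) x.
  rewrite big_cons big_cat /=; apply: (mulrI ku).
  by rewrite [in RHS]ek [RHS]mulrACA -ea -eb e ec /q -!mulrA mulVKr //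
    (mulrC p).
have hst x : x \in s ++ t -> irreducible x.
  by rewrite mem_cat => /orP[/sirr|/tirr].
have hqz x : x \in q :: z -> irreducible x.
  by rewrite inE => /predU1P[->|/zirr//]; apply: irreducible_unit_mul.
have [esz [t' pt ha]] := hA.2 _ _ hqz hst ep.
(* Index 0 is the position of [q], so the factor matched with it is a multiple of [p]. *)
have := ha 0%N (ltn0Sn _); rewrite /= => -[l _ et].
have dq : divides p t'`_0.
  by rewrite et /q mulrA; exists (l * (k^-1 * w)).
have : t'`_0 \in s ++ t.
  by rewrite (perm_mem pt) mem_nth // -(perm_size pt) -esz.
have dvd_prod r : t'`_0 \in r -> divides p (\prod_(x <- r) x).
  by move=> hr; rewrite (big_rem _ hr) /= mulrC; apply: divides_mul.
rewrite mem_cat ea eb => /orP[] /dvd_prod; first by left; apply: divides_mul.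
by right; apply: divides_mul.
Qed.

(** * Primes of a ring as constants of its polynomial ring, and Gauss's lemma *)

Lemma divides_add {A : comNzRingType} {p a b : A} :
  divides p a -> divides p b -> divides p (a + b).
Proof. by move=> [c ->] [d ->]; exists (c + d); rewrite mulrDl. Qed.

Lemma divides_opp {A : comNzRingType} {p a : A} :
  divides p a -> divides p (- a).
Proof. by move=> [c ->]; exists (- c); rewrite mulNr. Qed.

(** Divisibility by a constant is coefficientwise; the shape [f * 'X + c%:P] is the one that
    [poly_ind] produces. *)
Lemma divides_polyC {A : comNzRingType} (p : A) (f : {poly A}) (c : A) :
  divides p%:P (f * 'X + c%:P) <-> divides p%:P f /\ divides p c.
Proof.
split=> [[g e]|[[g ->] [d ->]]]; last first.
  by exists (g * 'X + d%:P); rewrite mulrDl mulrAC polyCM.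
have hc i : (f * 'X + c%:P)`_i = g`_i * p by rewrite e coefMC.
split; last first.
  by exists g`_0; rewrite -hc coefD coefMX coefC eqxx add0r.
exists (\poly_(i < size g) g`_i.+1); apply/polyP => i.
have := hc i.+1; rewrite coefD coefMX coefC /= addr0 => ->.
rewrite coefMC coef_poly; case: ltnP => // hi.
by rewrite nth_default // (leq_trans hi).
Qed.

(** Induction on both factors: [p] divides the product of their constant coefficients, hence one of
    these. Subtracting the multiple of [p] that this coefficient contributes and cancelling ['X]
    replaces that factor by a shorter one. *)
Lemma prime_element_polyC {A : idomainType} (p : A) :
  prime_element p -> prime_element p%:P.
Proof.
move=> [p0 pp]; split; first by rewrite polyC_eq0.
have d0 : divides p%:P (0 : {poly A}) by exists 0; rewrite mul0r.
elim/poly_ind => [|f c IHf]; first by left.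
elim/poly_ind => [|g d IHg]; first by right.
move=> h; have : divides p (c * d).
  have := h; rewrite mulrDr mulrA => -[k] /(congr1 (fun q : {poly A} => q`_0)).
  rewrite coefD coefMX coefMC !coefMC coefD coefMX coefC /= !add0r => ->.
  by exists k`_0.
case/pp => [hc|hd].
  have : divides p%:P (f * (g * 'X + d%:P)).
    have : divides p%:P ((f * (g * 'X + d%:P)) * 'X + 0%:P).
      have -> : f * (g * 'X + d%:P) * 'X + 0%:P =
        (f * 'X + c%:P) * (g * 'X + d%:P) - (g * 'X + d%:P) * c%:P.
        by rewrite mulrDl addr0 (mulrC c%:P) addrK mulrAC.
      apply: divides_add => //; apply: divides_opp; apply: divides_mul.
      by case: hc => k ->; exists k%:P; rewrite polyCM.
    by case/divides_polyC.
  case/IHf => hf; last by right.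
  by left; apply/divides_polyC.
have : divides p%:P ((f * 'X + c%:P) * g).
  have : divides p%:P (((f * 'X + c%:P) * g) * 'X + 0%:P).
    have -> : (f * 'X + c%:P) * g * 'X + 0%:P =
        (f * 'X + c%:P) * (g * 'X + d%:P) - (f * 'X + c%:P) * d%:P.
      by rewrite [X in _ = X - _]mulrDr addr0 addrK mulrA.
    apply: divides_add => //; apply: divides_opp; apply: divides_mul.
    by case: hd => k ->; exists k%:P; rewrite polyCM.
  by case/divides_polyC.
case/IHg => hg; first by left.
by right; apply/divides_polyC.
Qed.

(* Gauss's lemma, the prime factors of the denominator being distributed one at
   a time between the two factors. *)
Lemma gauss_split {R : idomainType} (hR : is_ufd R) (d : R)
    (T A B : {poly {poly R}}) :
  d != 0 -> d%:P%:P * T = A * B ->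
  exists e f A' B', [/\ A = e%:P%:P * A', B = f%:P%:P * B' & T = A' * B'].
Proof.
move=> d0; have [u [s [uu sirr ->]]] := unit_factorization hR _ d0.
elim: s T A B sirr {d0} => [|p s IHs] T A B sirr.
  rewrite big_nil mulr1 => e.
  exists 1, u, A, (u^-1%:P%:P * B); split; first by rewrite !polyC1 mul1r.
    by rewrite mulrA -!polyCM divrr // !polyC1 mul1r.
  by rewrite mulrCA -e mulrA -!polyCM mulVr // !polyC1 mul1r.
have pirr : irreducible p by apply: sirr; rewrite mem_head.
have sirr' q : q \in s -> irreducible q.
  by move=> qs; apply: sirr; rewrite in_cons qs orbT.
have [pn0 hp] : prime_element p%:P%:P.
  by do 2!apply: prime_element_polyC; apply: ufd_irreducible_prime.
rewrite big_cons mulrCA 2!polyCM -mulrA => e.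
have /hp : divides p%:P%:P (A * B).
  by rewrite -e; eexists; rewrite mulrC.
case=> [[A1 eA]|[B1 eB]].
  move: e; rewrite eA mulrAC [RHS]mulrC => /(mulfI pn0) /(IHs _ _ _ sirr').
  move=> [e [f [A' [B' [-> eB eT]]]]].
  by exists (p * e), f, A', B'; split=> //; rewrite 2!polyCM mulrC mulrA.
move: e; rewrite eB [RHS]mulrA [RHS]mulrC => /(mulfI pn0) /(IHs _ _ _ sirr').
move=> [e [f [A' [B' [eA -> eT]]]]].
by exists e, (p * f), A', B'; split=> //; rewrite 2!polyCM mulrC mulrA.
Qed.

(** * Clearing denominators in k[x,y] *)

Lemma frac_denominator {R : idomainType} (x : {fraction R}) :
  exists2 d : R, d != 0 & exists m, tofrac d * x = tofrac m.
Proof.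
elim/quotW: x => x; exists (frac x).2; first exact: denom_ratioP.
exists (frac x).1; rewrite -[LHS]/(FracField.mul _ _) !piE /FracField.mulf.
apply/eqmodP; rewrite /= FracField.equivfE.
rewrite !numden_Ratio ?(oner_eq0, mulf_neq0, denom_ratioP) //.
by rewrite !mul1r mulr1 mulrC.
Qed.

(** The map [g] keeps denominators in [R] itself, so that the lemma can be applied twice: to
    coefficients in k, then to coefficients in k[y]. *)
Lemma poly_common_denominator {A B : idomainType} (h : {rmorphism A -> B})
    {R : idomainType} (g : {rmorphism R -> A}) :
  injective g ->
  (forall x : B, exists2 d : R, d != 0 & exists m, h (g d) * x = h m) ->
  forall f : {poly B}, exists2 d : R, d != 0 &
    exists m, map_poly h (g d)%:P * f = map_poly h m.
Proof.
move=> gi hh; elim/poly_ind => [|f x [d d0 [m em]]].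
  by exists 1; [exact: oner_neq0 | exists 0; rewrite mulr0 rmorph0].
have [e e0 [l el]] := hh x.
exists (d * e); first exact: mulf_neq0.
exists ((g e)%:P * m * 'X + (g d * l)%:P).
rewrite !(rmorphM, rmorphD) /= -em map_polyX !map_polyC /= -el !rmorphM /=.
rewrite mulrDr; congr (_ + _); first by rewrite !mulrA (mulrC (h (g e))%:P).
by rewrite mulrA.
Qed.

Lemma tofrac_inj {R : idomainType} : injective (@tofrac R).
Proof. by move=> a b /eqP; rewrite tofrac_eq => /eqP. Qed.

Lemma to_fraction_field_inj {R : idomainType} :
  injective (@to_fraction_field R).
Proof.
exact: map_inj_poly (map_inj_poly tofrac_inj (rmorph0 _)) (rmorph0 _).
Qed.

Lemma to_fraction_fieldM {R : idomainType} (F G : {poly {poly R}}) :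
  to_fraction_field (F * G) = to_fraction_field F * to_fraction_field G.
Proof. by rewrite /to_fraction_field rmorphM. Qed.

Lemma to_fraction_fieldC {R : idomainType} (a : R) :
  to_fraction_field a%:P%:P = (tofrac a)%:P%:P.
Proof.
by rewrite /to_fraction_field map_polyC; congr polyC; apply: map_polyC.
Qed.

(** [F] divides a nonzero constant of the field k, and such a constant is a unit of k[x,y]. *)
Lemma fraction_constant_unit {R : idomainType} (a b : R)
    (F : {poly {poly {fraction R}}}) :
  F != 0 -> b != 0 ->
  to_fraction_field b%:P%:P * F = to_fraction_field a%:P%:P ->
  F \is a GRing.unit.
Proof.
move=> F0 b0; rewrite !to_fraction_fieldC => e.
have a0 : tofrac a != 0.
  by rewrite -2!polyC_eq0 -e mulf_neq0 // !polyC_eq0 tofrac_eq0.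
have : (tofrac a)%:P%:P \is a @GRing.unit {poly {poly {fraction R}}}.
  by do 2!apply: rmorph_unit; rewrite unitfE.
by rewrite -e unitrM => /andP[].
Qed.

Lemma to_fraction_field_denominator {R : idomainType}
    (F : {poly {poly {fraction R}}}) :
  exists2 d : R, d != 0 &
    exists G, to_fraction_field d%:P%:P * F = to_fraction_field G.
Proof.
have := poly_common_denominator (map_poly (@tofrac R)) (@polyC R)
  (@polyC_inj R).
apply=> f.
have := poly_common_denominator (@tofrac R) idfun (@inj_id R).
by apply=> x; apply: frac_denominator.
Qed.

(** * The polynomial P_U: multiplicativity, degree and low coefficients *)

(** Induction on [n]: 0 is a root of the product, hence of one factor, from which ['X] can be
    cancelled. *)
Lemma scaleXn_factor {R : idomainType} (c : R) (n : nat) (P Q : {poly R}) :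
  c != 0 -> P * Q = c *: 'X^n ->
  exists a b k l, [/\ P = a *: 'X^k, Q = b *: 'X^l & (k + l)%N = n].
Proof.
move=> c0; elim: n P Q => [|n IHn] P Q e.
  have : size (P * Q) == 1 by rewrite e expr0 alg_polyC size_polyC c0.
  rewrite size_mul_eq1 => /andP[/size_poly1P[a _ ->] /size_poly1P[b _ ->]].
  by exists a, b, 0%N, 0%N; rewrite expr0 !alg_polyC.
have : root (P * Q) 0 by rewrite e rootE hornerZ hornerXn expr0n mulr0.
have Xn0 : 'X != 0 :> {poly R} by rewrite polyX_eq0.
rewrite rootM => /orP[] /factor_theorem[S]; rewrite subr0 => eS; move: e;
  rewrite eS exprSr scalerAl.
  rewrite mulrAC => /(mulIf Xn0) /IHn[a [b [k [l [-> -> <-]]]]].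
  by exists a, b, k.+1, l; rewrite exprSr scalerAl.
rewrite mulrA => /(mulIf Xn0) /IHn[a [b [k [l [-> -> <-]]]]].
by exists a, b, k, l.+1; rewrite exprSr scalerAl addnS.
Qed.

(** This is P_U, written as a sum in R[y] rather than by substitution, so that its degree and
    coefficients can be read off. *)
Definition brylawski_poly {R : idomainType} (U : {poly {poly R}}) : {poly R} :=
  \sum_(i < size U) U`_i * 'X^i * ('X - 1) ^+ ((size U).-1 - i).

Lemma tofrac_brylawski_poly {R : idomainType} (U : {poly {poly R}}) :
  let y : {fraction {poly R}} := tofrac 'X in
  tofrac (brylawski_poly U) =
    (y - 1) ^+ degX U * (map_poly (@tofrac _) U).[y / (y - 1)].
Proof.
move=> y; have y1 : y - 1 != 0.
  by rewrite -tofrac1 -tofracB tofrac_eq0 -polyC1 polyXsubC_eq0.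
rewrite horner_coef (size_map_inj_poly tofrac_inj) ?rmorph0 //.
rewrite mulr_sumr rmorph_sum; apply: eq_bigr => i _ /=.
rewrite coef_map /= !tofracM !tofracXn tofracB tofrac1 -/y expr_div_n.
have -> : degX U = ((size U).-1 - i + i)%N.
  by rewrite subnK // -ltnS prednK // (leq_ltn_trans _ (ltn_ord i)).
rewrite exprD; move: (expf_neq0 i y1); set v := (y - 1) ^+ i => v0.
by rewrite [RHS]mulrC -!mulrA; congr (_ * (_ * _)); rewrite (mulrC _ v) mulKf.
Qed.

Lemma degXM {R : idomainType} (A B : {poly {poly R}}) :
  A * B != 0 -> degX (A * B) = (degX A + degX B)%N.
Proof.
rewrite mulf_eq0 negb_or => /andP[A0 B0]; rewrite /degX size_mul //.
move: A0 B0; rewrite -!size_poly_gt0.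
by case: (size A) (size B) => // a [|b] // _ _; rewrite addnS addSn.
Qed.

Lemma degY_swapXY {R : idomainType} (A : {poly {poly R}}) :
  degY A = degX (swapXY A).
Proof. by rewrite /degY sizeYE. Qed.

Lemma degYM {R : idomainType} (A B : {poly {poly R}}) :
  A * B != 0 -> degY (A * B) = (degY A + degY B)%N.
Proof.
move=> AB0; rewrite !degY_swapXY rmorphM degXM // -rmorphM.
by rewrite swapXY_eq0.
Qed.

(** In R(y), evaluation is multiplicative and the exponent deg_x is additive; injectivity of
    [tofrac] brings the identity back to R[y]. *)
Lemma brylawski_polyM {R : idomainType} (A B : {poly {poly R}}) :
  A * B != 0 -> brylawski_poly (A * B) = brylawski_poly A * brylawski_poly B.
Proof.
move=> AB0; apply/eqP; rewrite -tofrac_eq tofracM !tofrac_brylawski_poly.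
by rewrite degXM // rmorphM hornerM exprD mulrACA.
Qed.

Lemma size_brylawski_poly {R : idomainType} (U : {poly {poly R}}) :
  (size (brylawski_poly U) <= (degX U + degY U).+1)%N.
Proof.
apply: (leq_trans (size_sum _ _ _)); apply/bigmax_leqP => i _.
have hi : (i <= degX U)%N.
  by rewrite -ltnS prednK // (leq_ltn_trans _ (ltn_ord i)).
have hX : (size ('X^i * ('X - 1) ^+ ((size U).-1 - i) : {poly R})%R
           <= (degX U).+1)%N.
  rewrite (leq_trans (size_polyMleq _ _)) //.
  rewrite size_polyXn -polyC1 size_exp_XsubC -/(degX U).
  by rewrite addSn addnS /= subnKC.
rewrite -mulrA (leq_trans (size_polyMleq _ _)) // -subn1 leq_subLR add1n.
rewrite -addnS -addSn addnC leq_add //.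
exact: leq_trans (max_size_coefXY U i) (leqSpred _).
Qed.

Lemma brylawski_poly_coef0 {R : idomainType} (U : {poly {poly R}}) :
  (brylawski_poly U)`_0 = U`_0`_0 * (-1) ^+ degX U.
Proof.
rewrite -horner_coef0 horner_sum /degX.
case e: (size U) => [|m].
  move/eqP: e; rewrite size_poly_eq0 => /eqP ->.
  by rewrite big_ord0 !coef0 mul0r.
rewrite big_ord_recl big1 ?addr0 => [|i _]; rewrite !hornerE ?hornerXn /=.
  by rewrite subn0 horner_coef0.
by rewrite exprS mul0r mulr0 mul0r.
Qed.

(** Modulo y^2 only the terms i = 0 and i = 1 remain, each contributing its lowest coefficient times
    a power of -1. *)
Lemma brylawski_poly_coef1 {R : idomainType} (U : {poly {poly R}}) :
  (0 < degX U)%N -> U`_0`_0 = 0 ->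
  (brylawski_poly U)`_1 = (U`_1`_0 - U`_0`_1) * (-1) ^+ (degX U).-1.
Proof.
rewrite /degX /brylawski_poly; case: (size U) => [|[|m]] //= _ U00.
rewrite !big_ord_recl expr0 mulr1 subn0 subSS subn0 expr1 coefD.
rewrite coefM !big_ord_recl big_ord0 U00 mul0r add0r addr0 /=.
rewrite !coefD coef_sum big1 => [|i _]; last by rewrite mulrAC coefMXn.
have hc k : (('X - 1) ^+ k)`_0 = (-1) ^+ k :> R.
  by rewrite -horner_coef0 !hornerE.
rewrite addr0 mulrAC /bump coefMX /= coef0M !hc exprS.
by rewrite mulN1r mulrN addrC -mulrBl.
Qed.

(** The hypothesis reads (y-1)^r P_T = (y-1)^(deg_x T) c y^n. If deg_x T < r, setting y = 1 gives c
    = 0. Otherwise P_T = (y-1)^(deg_x T - r) c y^n, and the degree bound n forces deg_x T = r. *)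
Lemma brylawski_poly_monomial {R : idomainType} (n : nat) (r : int)
    (T : {poly {poly R}}) :
  1 <= r -> is_brylawski n r T -> (degX T + degY T = n)%N ->
  exists2 c, c != 0 & brylawski_poly T = c *: 'X^n.
Proof.
case: r => [r|//] _ [c c0 hT] hdeg; exists c => //.
have X1 : 'X - 1 != 0 :> {poly R} by rewrite -polyC1 polyXsubC_eq0.
have e : ('X - 1) ^+ r * brylawski_poly T = ('X - 1) ^+ degX T * (c *: 'X^n).
  apply/eqP; rewrite -tofrac_eq !tofracM tofrac_brylawski_poly !tofracXn.
  rewrite mulrCA tofracB tofrac1 -mul_polyC tofracM tofracXn.
  by apply/eqP; congr (_ * _); apply: hT.
have [lt|le] := ltnP (degX T) r.
  move: e; rewrite -(subnKC (ltnW lt)) exprD -mulrA.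
  move=> /(mulfI (expf_neq0 _ X1)) /(congr1 (horner^~ 1)) /eqP.
  rewrite !hornerE subrr expr0n subn_eq0.
  by rewrite leqNgt lt mul0r expr1n mulr1 eq_sym (negPf c0).
move: e; rewrite -(subnKC le) exprD -mulrA => /(mulfI (expf_neq0 _ X1)) e.
have := size_brylawski_poly T; rewrite e hdeg -polyC1 size_monicM.
- rewrite size_exp_XsubC size_scale // size_polyXn addSn /= addnS ltnS.
  by rewrite -[leqRHS]add0n leq_add2r leqn0 => /eqP ->; rewrite mul1r.
- exact/monic_exp/monicXsubC.
by rewrite -size_poly_gt0 size_scale // size_polyXn.
Qed.

(** * Factors of a polynomial whose P_U is a monomial of top degree *)

(** The four cases correspond to which of [degX A] and [degY A] vanish. *)
Lemma brylawski_poly_cases {R : idomainType} (A : {poly {poly R}}) (a : R) :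
  brylawski_poly A = a *: 'X^(degX A + degY A) ->
  [\/ exists b, A = b%:P%:P, divides 'X A, divides 'Y A
    | A`_0`_0 = 0 /\ A`_1`_0 = A`_0`_1].
Proof.
move=> e.
have A00 : (0 < degX A + degY A)%N -> A`_0`_0 = 0.
  move=> d0; have := congr1 (fun p : {poly R} => p`_0) e.
  rewrite brylawski_poly_coef0 coefZ coefXn (ltn_eqF d0) mulr0 => /eqP.
  by rewrite mulf_eq0 signr_eq0 orbF => /eqP.
have XE (C : idomainType) (p : {poly C}) : p`_0 = 0 -> exists q, p = q * 'X.
  move=> p0; have /factor_theorem[q] : root p 0.
    by rewrite rootE horner_coef0 p0.
  by rewrite subr0; exists q.
have [dX|dX] := posnP (degX A).
  have eA : A = (A`_0)%:P.
    by apply: size1_polyC; rewrite -subn_eq0 subn1; apply/eqP.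
  have [dY|dY] := posnP (degY A).
    constructor 1; exists A`_0`_0; rewrite {1}eA; congr polyC.
    apply: size1_polyC; apply: leq_trans (max_size_coefXY _ _) _.
    by rewrite -subn_eq0 subn1; apply/eqP.
  constructor 3; have [q eq] := XE _ _ (A00 (ltn_addl _ dY)).
  by exists q%:P; rewrite -polyCM -eq.
have h00 := A00 (ltn_addr _ dX).
have [dY|dY] := posnP (degY A).
  constructor 2; apply: (XE _ A).
  rewrite [LHS]size1_polyC ?h00 //; apply: leq_trans (max_size_coefXY _ _) _.
  by rewrite -subn_eq0 subn1; apply/eqP.
constructor 4; split=> //.
have := congr1 (fun p : {poly R} => p`_1) e.
rewrite brylawski_poly_coef1 // coefZ coefXn.
(* Both degrees are positive, so the exponent is at least 2 and the monomial has no term in y. *)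
have -> : (1%N == (degX A + degY A)%N) = false.
  by apply: ltn_eqF; rewrite -[2%N]/(1 + 1)%N leq_add.
move=> /eqP; rewrite mulr0 mulf_eq0 signr_eq0 orbF subr_eq0 => /eqP //.
Qed.

(** Both factors give monomials; their exponents are bounded by the respective top degrees and have
    the same sum as these, hence equal them. *)
Lemma brylawski_factor {R : idomainType} (c : R) (A B : {poly {poly R}}) :
  c != 0 -> A * B != 0 ->
  brylawski_poly (A * B) = c *: 'X^(degX (A * B) + degY (A * B)) ->
  exists a b, brylawski_poly A = a *: 'X^(degX A + degY A) /\
    brylawski_poly B = b *: 'X^(degX B + degY B).
Proof.
move=> c0 AB0 e.
have e' := e; rewrite brylawski_polyM // in e'.
have [a [b [k [l [eA eB ekl]]]]] := scaleXn_factor _ _ _ _ c0 e'.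
have : brylawski_poly A * brylawski_poly B != 0.
  by rewrite e' -size_poly_gt0 size_scale // size_polyXn.
rewrite mulf_eq0 negb_or => /andP[].
rewrite eA eB -!mul_polyC !mulf_eq0 !negb_or !polyC_eq0.
move=> /andP[a0 _] /andP[b0 _].
exists a, b.
have := size_brylawski_poly A; have := size_brylawski_poly B.
rewrite eA eB !size_scale // !size_polyXn !ltnS.
move: ekl; rewrite degXM // degYM // addnACA.
move: (degX A + degY A)%N (degX B + degY B)%N => p q ekl lq kp.
have := (leqif_add (leqif_eq kp) (leqif_eq lq)).2; rewrite ekl eqxx => /esym.
by case/andP=> /eqP-> /eqP->; rewrite !mul_polyC.
Qed.

Lemma brylawski_factor_constant {R : idomainType} (n : nat) (r : int)
    (T A B : {poly {poly R}}) :
  1 <= r -> is_brylawski n r T -> (degX T + degY T = n)%N ->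
  ~ divides 'X T -> ~ divides 'Y T -> ~ divides (2%:~R : R) T`_1`_1 ->
  T = A * B -> (exists a, A = a%:P%:P) \/ (exists b, B = b%:P%:P).
Proof.
move=> hr hT hdeg hx hy h2 eT.
have [c c0 e] := brylawski_poly_monomial n r T hr hT hdeg.
rewrite -hdeg eT in e.
have T0 : A * B != 0.
  rewrite -eT; apply/eqP => T0; apply: hx.
  by rewrite T0; exists 0; rewrite mul0r.
have [a [b [eA eB]]] := brylawski_factor c A B c0 T0 e.
have TA p : divides p A -> divides p T.
  by rewrite eT mulrC; apply: divides_mul.
have TB p : divides p B -> divides p T.
  by rewrite eT; apply: divides_mul.
have [|/TA//|/TA//|[A00 A10]] := brylawski_poly_cases A a eA; first by left.
have [|/TB//|/TB//|[B00 B10]] := brylawski_poly_cases B b eB; first by right.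
(* Since a_(0,0) = b_(0,0) = 0, only the two cross terms of t_(1,1) survive, and they are equal. *)
case: h2; exists (A`_1`_0 * B`_1`_0).
rewrite eT coefM big_ord_recl big_ord1 coefD !coefM !big_ord_recl !big_ord0 /=.
rewrite /bump /= A00 B00 -A10 -B10 !mul0r !mulr0 !add0r !addr0.
by rewrite -[2%:~R]/(2%:R) mulr_natr mulr2n.
Qed.

(** * Irreducibility over k and over [R] *)

Theorem theorem2p13 (R : idomainType) (hR : is_ufd R)
  (n : nat) (r : int) (T : {poly {poly R}})
  (hr : 1 <= r) (hnr : 1 <= n%:Z - r)
  (hT : is_brylawski n r T)
  (hx1 : ~ divides ('X - 1) T)
  (hy1 : ~ divides ('Y - 1) T)
  (hx : ~ divides 'X T)
  (hy : ~ divides 'Y T)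
  (h2 : ~ divides (2%:~R : R) T`_1`_1)
  (hdeg : (degX T + degY T = n)%N) :
  irreducible (to_fraction_field T)
  /\ (is_gcd (fun i j : nat => T`_i`_j) 1 -> irreducible T).
Proof.
have constant A B := brylawski_factor_constant n r T A B hr hT hdeg hx hy h2.
have T0 : T != 0.
  by apply/eqP => T0; apply: hx; rewrite T0; exists 0; rewrite mul0r.
(* A unit of k[x,y] has degree 0 in x, so t_(1,1) would be 0, which 2 divides. *)
have Tu : to_fraction_field T \isn't a GRing.unit.
  rewrite poly_unitE; apply/negP => /andP[/eqP s1 _]; apply: h2.
  have sT : (size T <= 1)%N.
    have /size_map_inj_poly/(_ (rmorph0 _) T) <- :=
      map_inj_poly (@tofrac_inj R) (rmorph0 _).
    by rewrite [X in (X <= 1)%N]s1.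
  by exists 0; rewrite mul0r (size1_polyC sT) coefC coef0.
have toT0 : to_fraction_field T != 0.
  apply: contra_neq T0 => e; apply: to_fraction_field_inj.
  by rewrite e /to_fraction_field rmorph0.
split; last first.
  move=> [_ hgcd]; split=> //.
    by apply: contra Tu => /(rmorph_unit (map_poly (map_poly (@tofrac R)))).
  (* A constant factor divides every coefficient of [T], hence their gcd 1. *)
  have unit_constant a A : T = a%:P%:P * A ->
      a%:P%:P \is a @GRing.unit {poly {poly R}}.
    move=> eT; have [|b eb] := hgcd a.
      by move=> i j; exists A`_i`_j; rewrite eT !coefCM mulrC.
    apply/unitrPr; exists b%:P%:P; rewrite -!polyCM mulrC -eb //.
  move=> A B eT; have [[a ea]|[b eb]] := constant A B eT.
    by left; rewrite ea; apply: (unit_constant a B); rewrite -ea.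
  by right; rewrite eb; apply: (unit_constant b A); rewrite -eb mulrC.
split=> // A B eT.
have [d d0 [A1 eA1]] := to_fraction_field_denominator A.
have [e e0 [B1 eB1]] := to_fraction_field_denominator B.
(* Clearing denominators yields a factorization over [R] of a multiple of [T], to which Gauss's
   lemma applies. *)
have eT1 : (d * e)%:P%:P * T = A1 * B1.
  apply: to_fraction_field_inj; rewrite !to_fraction_fieldM -eA1 -eB1 eT.
  by rewrite 2!polyCM to_fraction_fieldM -!mulrA; congr (_ * _); rewrite mulrCA.
have [f [g [A' [B' [eA' eB' eT']]]]] :=
  gauss_split hR _ _ _ _ (mulf_neq0 d0 e0) eT1.
move: toT0; rewrite eT mulf_eq0 negb_or => /andP[A0 B0].
(* If [A'] is the constant [a], then d A = f a, so [A] is a nonzero constant of k; likewise for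
   [B]. *)
case: (constant A' B' eT') => [[a ea]|[b eb]].
  left; apply: (fraction_constant_unit (f * a) d) => //.
  by rewrite eA1 eA' ea -!polyCM.
right; apply: (fraction_constant_unit (g * b) e) => //.
by rewrite eB1 eB' eb -!polyCM.
Qed.
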